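(* Let $\mu$ be a Borel probability measure on a compact topological space $\Omega$ and let $V_n$ be an $n$-dimensional subspace of $C(\Omega)$, the space of continuous complex-valued functions on $\Omega$. Then there exist an $N\le\dim(\operatorname{span}\{f\cdot\overline g : f,g\in V_n\})\le n^2$ and $N+1$ points $x_1,\dots,x_{N+1}\in\Omega$ together with non-negative weights $\mu_1,\dots,\mu_{N+1}$ satisfying $\sum_{i=1}^{N+1}\mu_i=1$ such that $$\int_\Omega|f(x)|^2\,\mathrm d\mu(x)=\sum_{i=1}^{N+1}\mu_i|f(x_i)|^2\quad\text{for all } f\in V_n .$$
   Context: Dimensions and spans are over $\mathbb{C}$. *)

(* Defs.v *)
From HB Require Import structures.
From mathcomp Require Import all_boot all_order all_algebra.
From mathcomp Require Import all_classical all_reals all_analysis.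
From mathcomp Require Import complex.

Set Implicit Arguments.
Unset Strict Implicit.
Unset Printing Implicit Defensive.

Import Order.TTheory GRing.Theory Num.Theory numFieldNormedType.Exports.

Local Open Scope classical_set_scope.
Local Open Scope ring_scope.

Section LinearAlgebra.
Context {K : fieldType} {E : lmodType K}.

Definition linear_subspace (W : set E) : Prop :=
  W 0 /\ forall (a : K) (u v : E), W u -> W v -> W (a *: u + v).

Definition linear_span (A : set E) : set E :=
  [set v | exists m (a : 'I_m -> K) (u : 'I_m -> E),
     (forall i, A (u i)) /\ v = \sum_(i < m) a i *: u i].

Definition linearly_independent m (b : 'I_m -> E) : Prop :=
  forall a : 'I_m -> K, \sum_(i < m) a i *: b i = 0 -> forall i, a i = 0.

(* MathComp's \dim only applies inside an ambient vectType, which is finite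
   dimensional; function spaces need not be, so dimension is a relation. *)
Definition has_dim (W : set E) (m : nat) : Prop :=
  exists b : 'I_m -> E, linearly_independent b /\ linear_span (range b) = W.

End LinearAlgebra.

(* R[i] has no canonical topology; R[i]^o is normed by the complex modulus. *)
Definition continuous_functions (R : realType) (T : topologicalType) :
    set (T -> R[i]^o) :=
  [set f | continuous f].
Arguments continuous_functions : clear implicits.

Definition conj_products (R : realType) (T : Type) (V : set (T -> R[i]^o)) :
    set (T -> R[i]^o) :=
  [set h | exists f g, [/\ V f, V g & h = fun x => f x * conjc (g x)]].

Definition sqr_modulus (R : realType) (z : R[i]) : R := Normc.normc z ^+ 2.

(* Main.v *)
Require Import Defs.
From HB Require Import structures.
From mathcomp Require Import all_boot all_order all_algebra.
From mathcomp Require Import all_classical all_reals all_analysis.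
From mathcomp Require Import measurable_realfun complex ring lra.

Import Order.TTheory GRing.Theory Num.Theory numFieldNormedType.Exports.

Local Open Scope classical_set_scope.
Local Open Scope ring_scope.

(** The span of the products [f * conj g] has a basis of real continuous functions
    [h_1, ..., h_D], and each [|f|^2] is a real combination of them. The vector of
    means of the [h_k] satisfies every linear inequality valid on the image of
    [h], hence lies in the closed convex hull of this compact subset of [R^D];
    by Caratheodory it is a convex combination of [D + 1] points of the image. *)

(** * Linear spans and bases drawn from a spanning family *)

Section Spans.
Context {K : fieldType} {E : lmodType K}.
Implicit Types (A W : set E).

Lemma linear_subspace_sum W (I : finType) (a : I -> K) (u : I -> E) :
  linear_subspace W -> (forall i, W (u i)) -> W (\sum_i a i *: u i).
Proof.
move=> [W0 WD] Wu; elim/big_rec : _ => // i v _ Wv.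
exact: WD.
Qed.

Lemma linear_span_subspace A : linear_subspace (linear_span A).
Proof.
split.
  exists 0%N, (fun=> 0), (fun=> 0); split; first by case.
  by rewrite big_ord0.
move=> c _ _ [m [a [u [Au ->]]]] [m' [a' [u' [Au' ->]]]].
exists (m + m')%N.
exists (fun i =>
  match fintype.split i with inl j => c * a j | inr j => a' j end).
exists (fun i => match fintype.split i with inl j => u j | inr j => u' j end).
split; first by move=> i; case: (fintype.split i).
rewrite big_split_ord /= scaler_sumr; congr (_ + _); apply: eq_bigr => i _.
  by rewrite (unsplitK (inl i)) scalerA.
by rewrite (unsplitK (inr i)).
Qed.

Lemma sub_linear_span A : A `<=` linear_span A.
Proof.
move=> v Av; exists 1%N, (fun=> 1), (fun=> v); split=> //.
by rewrite big_ord1 scale1r.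
Qed.

Lemma linear_span_min A W :
  linear_subspace W -> A `<=` W -> linear_span A `<=` W.
Proof.
move=> WW AW _ [m [a [u [Au ->]]]].
by apply: linear_subspace_sum => // i; exact: AW.
Qed.

Lemma linear_span_eq A B :
  A `<=` linear_span B -> B `<=` linear_span A -> linear_span A = linear_span B.
Proof.
move=> AB BA; apply/seteqP; split;
  by apply: linear_span_min => //; exact: linear_span_subspace.
Qed.

Lemma linear_span_rangeP (I : finType) (u : I -> E) v :
  linear_span (range u) v -> exists a : I -> K, v = \sum_i a i *: u i.
Proof.
apply: (@linear_span_min _ [set v | exists a : I -> K, v = \sum_i a i *: u i]).
  split.
    by exists (fun=> 0); rewrite big1 // => i _; rewrite scale0r.
  move=> c _ _ [a ->] [b ->]; exists (fun i => c * a i + b i).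
  rewrite scaler_sumr -big_split /=; apply: eq_bigr => i _.
  by rewrite scalerDl scalerA.
move=> _ [i _ <-]; exists (fun j => (j == i)%:R).
rewrite (bigD1 i) //= eqxx scale1r big1 ?addr0 // => j /negbTE ->.
by rewrite scale0r.
Qed.

(* A spanning family drawn from A of least cardinality is independent. *)
Lemma has_basis_in (I : finType) (u : I -> E) A :
  (forall i, A (u i)) ->
  exists (D : nat) (h : 'I_D -> E),
    [/\ (D <= #|I|)%N, forall i, A (h i), linearly_independent h
      & linear_span (range h) = linear_span (range u)].
Proof.
move=> Au.
pose spans D := `[< exists h : 'I_D -> E, (forall i, A (h i)) /\
  linear_span (range h) = linear_span (range u) >].
have spansI : spans #|I|.
  apply/asboolP; exists (u \o enum_val); split=> [i|]; first exact: Au.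
  congr linear_span; apply/seteqP; split=> [_ [i _ <-]|_ [i _ <-]].
    by exists (enum_val i).
  by exists (enum_rank i) => //=; rewrite enum_rankK.
have [D /asboolP[h [Ah spanh]] minD] := ex_minnP (ex_intro spans _ spansI).
exists D, h; split=> //; first exact: minD.
move=> a ha0 i; apply/eqP/negP => /negP ai0.
case: D => [|D] in h Ah spanh minD a ha0 i ai0 *; first by case: i {ai0}.
suff : spans D by move=> /minD; rewrite ltnn.
apply/asboolP; exists (h \o lift i); split=> [j|]; first exact: Ah.
rewrite -spanh; apply: linear_span_eq => _ [j _ <-].
  by apply: sub_linear_span; exists (lift i j).
have [k ->|->] := unliftP i j.
  by apply: sub_linear_span; exists k.
(* Solving the relation for [h i], whose coefficient is nonzero, makes this vector redundant,
   against the minimality of the cardinality. *)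
have -> : h i = \sum_k (- (a i)^-1 * a (lift i k)) *: h (lift i k).
  move: ha0; rewrite (bigD1_ord i) //= => /eqP; rewrite addr_eq0 => /eqP ahi.
  apply: (scalerI ai0); rewrite ahi scaler_sumr -sumrN; apply: eq_bigr => k _.
  by rewrite scalerA mulrA mulrN divff// mulN1r scaleNr.
apply: linear_subspace_sum; first exact: linear_span_subspace.
by move=> k; apply: sub_linear_span; exists k.
Qed.

End Spans.

(** * Affine dependences and the Carathéodory reduction *)

(** The [D + 2] rows [(1, a i)] live in dimension [D + 1], so they have a nontrivial linear
    relation; the constant column forces its coefficients to sum to zero. *)
Lemma affine_dependence (F : fieldType) (D : nat) (a : 'I_D.+2 -> 'I_D -> F) :
  exists c : 'I_D.+2 -> F, [/\ exists i, c i != 0, \sum_i c i = 0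
    & forall j, \sum_i c i * a i j = 0].
Proof.
pose M : 'M[F]_(D.+2, 1 + D) := row_mx (const_mx 1) (\matrix_(i, j) a i j).
have /rowV0Pn[v /sub_kermxP vM v0] : kermx M != 0.
  by rewrite kermx_eq0 /row_free ltn_eqF// ltnS rank_leq_col.
exists (v ord0); split.
- by move/rV0Pn : v0 => [i vi0]; exists i.
- move/matrixP : vM => /(_ ord0 (lshift D ord0)); rewrite !mxE => vM0.
  rewrite -[RHS]vM0.
  by apply: eq_bigr => i _; rewrite row_mxEl mxE mulr1.
- move=> j; move/matrixP : vM => /(_ ord0 (rshift 1 j)); rewrite !mxE => vM0.
  rewrite -[RHS]vM0.
  by apply: eq_bigr => i _; rewrite row_mxEr mxE.
Qed.

(** Subtracting [t * c] from the weights, for an affine dependence [c], changes neither their total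
    nor the weighted sum of the points. With [t] the least ratio [w i / c i] over [c i > 0], all
    weights stay non-negative and the one attaining the minimum vanishes. *)
Lemma caratheodory_step (R : realFieldType) (D : nat) (a : 'I_D.+2 -> 'I_D -> R)
    (w : 'I_D.+2 -> R) :
  (forall i, 0 <= w i) ->
  exists k (w' : 'I_D.+2 -> R), [/\ w' k = 0, forall i, 0 <= w' i,
    \sum_i w' i = \sum_i w i
    & forall j, \sum_i w' i * a i j = \sum_i w i * a i j].
Proof.
move=> w0.
have [c [[i0 ci0] c0 ca0]] := affine_dependence _ _ a.
(* A nonzero family with zero sum has a positive entry, so the least ratio exists. *)
have [i1 ci1] : exists i, 0 < c i.
  apply/not_existsP => cle0; move/eqP: ci0; apply; apply/eqP.
  have /eqP := c0; rewrite -oppr_eq0 -sumrN psumr_eq0 => [/allP|i _].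
    by move=> /(_ i0 (mem_index_enum _)); rewrite oppr_eq0.
  by rewrite oppr_ge0 leNgt; apply/negP/cle0.
case: (@arg_minP _ _ _ i1 (fun i => 0 < c i) (fun i => w i / c i) ci1).
move=> k ck mink.
pose t := w k / c k.
have t0 : 0 <= t by rewrite divr_ge0 // ltW.
exists k, (fun i => w i - t * c i); split.
- by rewrite /t divfK ?subrr// gt_eqF.
- move=> i; rewrite subr_ge0; have [ci|ci] := ltrP 0 (c i).
    by rewrite -ler_pdivlMr//; exact: mink.
  by apply: le_trans (w0 i); rewrite mulr_ge0_le0.
- by rewrite sumrB -mulr_sumr c0 mulr0 subr0.
- move=> j; under eq_bigr do rewrite mulrBl -mulrA.
  by rewrite sumrB -mulr_sumr ca0 mulr0 subr0.
Qed.

(** * Nearest points among convex combinations of a compact image *)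

(** First-order condition: the squared norm of [d + t e] has slope [2 <d, e>] at [t = 0]. An
    explicit [t] replaces the limit. *)
Lemma sqr_dist_min_dot (R : realFieldType) (D : nat) (d e : 'I_D -> R) :
  (forall t, 0 < t <= 1 ->
    \sum_j d j ^+ 2 <= \sum_j (d j + t * e j) ^+ 2) ->
  0 <= \sum_j d j * e j.
Proof.
move=> mind; rewrite leNgt; apply/negP => de0.
set s := \sum_j d j * e j in de0.
pose q := \sum_j e j ^+ 2.
have q0 : 0 <= q by apply: sumr_ge0 => j _; exact: sqr_ge0.
have mindq t : 0 < t <= 1 -> 0 <= t * (2 * s + t * q).
  move=> /mind; rewrite -subr_ge0 -sumrB => /le_trans; apply.
  rewrite mulrDr mulrCA (mulrA t t) /s /q !mulr_sumr -big_split /=.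
  apply: ler_sum => j _; rewrite le_eqVlt; apply/orP; left; apply/eqP; ring.
(* As [s < 0 <= q], this [t] lies in [(0, 1]], and [2 s + t q = s (1 + t) < 0] contradicts
   [mindq]. *)
pose t := - s / (q - s).
have qs : 0 < q - s by lra.
have t01 : 0 < t <= 1.
  by rewrite /t divr_gt0 ?oppr_gt0//= ler_pdivrMr// mul1r; lra.
have tqs : t * (q - s) = - s by rewrite /t divfK ?gt_eqF.
have := mindq _ t01; move/andP: t01 => [t0 t1].
rewrite pmulr_rge0//; nra.
Qed.

Lemma continuous_sum_sqr_dist (R : realType) (Z : topologicalType) k D
    (w : 'I_k -> Z -> R) (y : 'I_k -> 'I_D -> Z -> R) (p : 'I_D -> R) :
  (forall i, continuous (w i)) -> (forall i j, continuous (y i j)) ->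
  continuous (fun z => \sum_j (\sum_i w i z * y i j z - p j) ^+ 2).
Proof.
move=> cw cy; apply: continuous_big => [|j _]; first exact: add_continuous.
have cs : continuous (fun z => \sum_i w i z * y i j z).
  apply: continuous_big => [|i _]; first exact: add_continuous.
  by move=> z; exact: (continuousM (cw i z) (cy i j z)).
move=> z; have cd := continuousB (cs z) (@cst_continuous _ _ (p j) z).
exact: (continuous_comp cd (@exprn_continuous R 2 _)).
Qed.

Section Quadrature.
Context {R : realType} {X : ptopologicalType} (D : nat) (h : 'I_D -> X -> R).

(** Weights carry the product topology, so that Tychonoff's theorem gives compactness of the cube
    containing them. *)
Let simplex k : set (prod_topology (fun _ : 'I_k => R)) :=
  [set w | (forall i, 0 <= w i) /\ \sum_i w i = 1].

Let compact_simplex k : compact (simplex k).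
Proof.
have -> : simplex k =
    [set w | forall i, [set` `[0, 1]%R] (w i)] `&` [set w | \sum_i w i = 1].
  apply/seteqP; split=> w /= [w01 w1]; split=> // i.
    by rewrite in_itv /= w01 -w1 (bigD1 i)//= lerDl sumr_ge0.
  by have := w01 i; rewrite in_itv /= => /andP[].
apply: compact_closedI.
  apply: (@tychonoff _ (fun=> R) (fun=> [set` `[0, 1]%R])) => i.
  exact: segment_compact.
apply: (@closed_comp _ _ (fun w : prod_topology (fun _ : 'I_k => R) =>
  \sum_i w i) [set 1]).
  move=> w _; apply: continuous_big.
    exact: add_continuous.
  by move=> i _; exact: proj_continuous.
exact: closed_eq.
Qed.

Definition sqr_dist k (p : 'I_D -> R) (w : 'I_k -> R) (x : 'I_k -> X) : R :=
  \sum_j (\sum_i w i * h j (x i) - p j) ^+ 2.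

Hypotheses (cX : compact [set: X]) (ch : forall j, continuous (h j)).

(** Minimising jointly over weights and points, on a compact product, avoids proving that the convex
    hull is compact. With [k.+1] points the simplex is nonempty. *)
Let sqr_dist_min k p : exists (w : 'I_k.+1 -> R) (x : 'I_k.+1 -> X),
  simplex k.+1 w /\ forall w' x', simplex k.+1 w' ->
    sqr_dist k.+1 p w x <= sqr_dist k.+1 p w' x'.
Proof.
pose W := prod_topology (fun _ : 'I_k.+1 => R).
pose Y := prod_topology (fun _ : 'I_k.+1 => X).
have cY : compact [set: Y].
  have := @tychonoff _ (fun _ : 'I_k.+1 => X) (fun=> [set: X]) (fun=> cX).
  by congr compact; apply/seteqP; split.
have [||| [w x] /set_mem[/= Sw _] minwx] := @compact_EVT_min (W * Y)%type R
    (fun z : W * Y => sqr_dist k.+1 p z.1 z.2) (simplex k.+1 `*` setT).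
- exists ((fun i => (i == ord0)%:R), fun=> point); split=> //=; split=> [i|].
    by rewrite ler0n.
  by rewrite (bigD1 ord0)//= big1 ?addr0// => i /negbTE ->.
- by apply: compact_setX => //; exact: compact_simplex.
- apply: continuous_subspaceT.
  apply: (@continuous_sum_sqr_dist R (W * Y)%type k.+1 D (fun i z => z.1 i)
    (fun i j z => h j (z.2 i)) p) => [i z|i j z].
    apply: (@continuous_comp (W * Y)%type W R fst (proj i)).
      exact: cvg_fst.
    exact: proj_continuous.
  apply: (@continuous_comp (W * Y)%type X R (fun z => z.2 i) (h j)).
    apply: (@continuous_comp (W * Y)%type Y X snd (proj i)).
      exact: cvg_snd.
    exact: proj_continuous.
  exact: ch.
- exists w, x; split=> // w' x' Sw'.
  by apply: (minwx (w', x')); apply/mem_set.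
Qed.

(* The premise says that p is in every closed half-space containing the image of
   h. The nearest point q to p among combinations of D + 1 points is nearest
   among all convex combinations, so <p - q, h y - q> <= 0 for all y, and the
   half-space with normal p - q gives p = q. *)
Lemma convex_quadrature (p : 'I_D -> R) :
  (forall (c : 'I_D -> R) s,
    (forall x, \sum_j c j * h j x <= s) -> \sum_j c j * p j <= s) ->
  exists (x : 'I_D.+1 -> X) (w : 'I_D.+1 -> R),
    [/\ forall i, 0 <= w i, \sum_i w i = 1
      & forall j, p j = \sum_i w i * h j (x i)].
Proof.
move=> supp.
have [w [x [[w0 w1] minwx]]] := sqr_dist_min D p.
exists x, w; split=> //.
pose q j := \sum_i w i * h j (x i).
have dot y : 0 <= \sum_j (q j - p j) * (h j y - q j).
  apply: sqr_dist_min_dot => t /andP[t0 t1].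
  (* The point [q + t (h y - q)] is a convex combination of [D + 2] points of the image: index
     [ord0] carries [y] with weight [t], the others the old points with weights scaled by
     [1 - t]. *)
  pose a i j := h j (if unlift ord0 i is Some i' then x i' else y).
  pose u i := if unlift ord0 i is Some i' then (1 - t) * w i' else t.
  have u0 i : 0 <= u i.
    rewrite /u; case: unliftP => [i' _|_]; last exact: ltW.
    by rewrite mulr_ge0// subr_ge0.
  (* One reduction frees index [k]; reindexing by [lift k] leaves [D + 1] points, to which the
     minimality of [w] and [x] applies. *)
  have [k [u' [u'k u'0 u'1 u'a]]] := caratheodory_step _ _ a u u0.
  have dropk (f : 'I_D.+2 -> R) :
      \sum_i u' (lift k i) * f (lift k i) = \sum_i u' i * f i.
    by rewrite [RHS](bigD1_ord k)//= u'k mul0r add0r.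
  have Su' : simplex D.+1 (fun i => u' (lift k i)).
    split=> [i|]; first exact: u'0.
    have := dropk (fun=> 1); under eq_bigr do rewrite mulr1.
    move=> ->; under eq_bigr do rewrite mulr1.
    rewrite u'1 (bigD1_ord ord0)//= /u unlift_none.
    under eq_bigr do rewrite liftK.
    by rewrite -mulr_sumr w1 mulr1 addrC subrK.
  have := minwx _
    (fun i => if unlift ord0 (lift k i) is Some i' then x i' else y) Su'.
  congr (_ <= _); apply: eq_bigr => j _; congr (_ ^+ 2).
  rewrite (dropk (a ^~ j)) u'a (bigD1_ord ord0)//= /u /a unlift_none.
  under eq_bigr do rewrite liftK -mulrA.
  by rewrite -mulr_sumr -/(q j); ring.
have : \sum_j (p j - q j) * p j <= \sum_j (p j - q j) * q j.
  apply: supp => y; rewrite -subr_ge0 -sumrB; apply: le_trans (dot y) _.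
  by rewrite le_eqVlt; apply/orP; left; apply/eqP/eq_bigr => j _; ring.
(* The inequality now says that the squared norm of [p - q] is at most zero. *)
rewrite -subr_le0 -sumrB => pq0 j; apply/eqP; rewrite -subr_eq0 -sqrf_eq0.
have : \sum_j (p j - q j) ^+ 2 == 0.
  rewrite eq_le sumr_ge0 ?andbT => [|i _]; last exact: sqr_ge0.
  apply: le_trans pq0; rewrite le_eqVlt; apply/orP; left.
  by apply/eqP/eq_bigr => i _; ring.
rewrite psumr_eq0 => [/allP|i _]; last exact: sqr_ge0.
by move=> /(_ j (mem_index_enum _)).
Qed.

End Quadrature.

(** * Integration of continuous functions on a compact space *)

Section ContinuousIntegrable.
Context {R : realType} {Omega : ptopologicalType}.
Variable mu : probability (g_sigma_algebraType (@open Omega)) R.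
Hypothesis cOmega : compact [set: Omega].

(** Preimages of open intervals are open, hence Borel; compactness bounds the function and the
    measure is finite. *)
Lemma continuous_integrable (f : Omega -> R) :
  continuous f -> mu.-integrable [set: Omega] (EFin \o f).
Proof.
move=> cf; apply: (@measurable_bounded_integrable _ _ R mu f) => //.
- by rewrite (le_lt_trans (probability_le1 _ _))// ltry.
- apply: (measurability _ (RGenOpens.measurableE R)).
  move=> _ [_ [a [b ->] <-]]; rewrite setTI.
  apply: sub_sigma_algebra; apply: open_comp; first by move=> x _; exact: cf.
  exact: interval_open.
- have /compact_bounded[M [Mr bM]] : compact (range f).
    by apply: continuous_compact => //; exact: continuous_subspaceT.
  by exists M; split=> // N MN x _; apply: (bM N MN); exists x.
Qed.

Lemma Rintegral_sum_continuous D (h : 'I_D -> Omega -> R) (c : 'I_D -> R) :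
  (forall j, continuous (h j)) ->
  (\int[mu]_y (\sum_j c j * h j y)%:E =
   (\sum_j c j * \int[mu]_y h j y)%R%:E)%E.
Proof.
move=> ch.
have ih j := continuous_integrable (h j) (ch j).
under eq_integral do rewrite -sumEFin.
rewrite integral_sum//=.
  rewrite -sumEFin; apply: eq_bigr => j _.
  under eq_integral do rewrite EFinM.
  rewrite integralZl//; last exact: ih.
  rewrite EFinM; congr (_ * _)%E.
  by rewrite /Rintegral fineK//; exact: (integrable_fin_num _ (ih j)).
move=> j; under eq_fun do rewrite EFinM.
by apply: integrableZl => //; exact: ih.
Qed.

End ContinuousIntegrable.

(** * Continuity of real and imaginary parts *)

Section ComplexContinuity.
Context {R : realType} {T : topologicalType}.
Implicit Types f : T -> R[i]^o.

Lemma continuous_Re f : continuous f -> continuous (fun x => complex.Re (f x)).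
Proof.
move=> cf x; apply/cvgrPdist_lt => e e0.
have /cvgrPdist_lt /(_ (e%:C)%C) := cf x; rewrite ltcR => /(_ e0).
apply: filterS => y; rewrite -ltcR; apply: le_lt_trans.
by rewrite -raddfB; exact: normc_ge_Re.
Qed.

Lemma continuous_Im f : continuous f -> continuous (fun x => complex.Im (f x)).
Proof.
move=> cf x; apply/cvgrPdist_lt => e e0.
have /cvgrPdist_lt /(_ (e%:C)%C) := cf x; rewrite ltcR => /(_ e0).
apply: filterS => y; rewrite -ltcR; apply: le_lt_trans.
rewrite -raddfB normc_def lecR -sqrtr_sqr ler_sqrt ?addr_ge0 ?sqr_ge0//.
by rewrite lerDr sqr_ge0.
Qed.

End ComplexContinuity.

(** * Real generators for the span of the products [f * conj g] *)

Section RealProducts.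
Context {R : realType}.

(** One real function per ordered pair of basis vectors keeps the count at [n^2]; real and imaginary
    parts taken separately would give [2 n^2]. The value is embedded in [R[i]] because spans are
    complex. *)
Definition re_add_im (z : R[i]) : R[i] := (complex.Re z + complex.Im z)%:C%C.

(* Since conj(z) w is the conjugate of z conj(w), the products f conj(g) and
   g conj(f) span the same plane as the real functions Re + Im of each of them;
   (1 + i)/2 and its conjugate are the coefficients of this change of basis. *)
Definition half_1i : R[i] := (2^-1 +i* 2^-1)%C.

Lemma re_add_imE (z w : R[i]) :
  re_add_im (z * conjc w) =
  conjc half_1i * (z * conjc w) + half_1i * (w * conjc z).
Proof.
case: z w => [a b] [c d]; apply/eqP; rewrite eq_complex /=.
by apply/andP; split; apply/eqP; field.
Qed.

Lemma mul_conjcE (z w : R[i]) :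
  z * conjc w = half_1i * re_add_im (z * conjc w)
              + conjc half_1i * re_add_im (w * conjc z).
Proof.
case: z w => [a b] [c d]; apply/eqP; rewrite eq_complex /=.
by apply/andP; split; apply/eqP; field.
Qed.

(** This polynomial form gives the continuity of the real generators. *)
Lemma Re_mul_conjc_add_Im (z w : R[i]) :
  complex.Re (z * conjc w) + complex.Im (z * conjc w) =
  complex.Re z * complex.Re w + complex.Im z * complex.Im w
  + (complex.Im z * complex.Re w - complex.Re z * complex.Im w).
Proof. by case: z w => [p q] [r s] /=; ring. Qed.

Lemma sqr_modulusE (z : R[i]) : sqr_modulus z = complex.Re (z * conjc z).
Proof.
case: z => a b; rewrite /sqr_modulus /= sqr_sqrtr ?addr_ge0 ?sqr_ge0//.
by rewrite mulrN opprK !expr2.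
Qed.

(** Turns an expansion of [|f|^2] with complex coefficients in a real basis into one with real
    coefficients. *)
Lemma Re_linear_comb (I : finType) (a h : I -> R[i]) :
  (forall k, complex.Im (h k) = 0) ->
  complex.Re (\sum_k a k * h k) = \sum_k complex.Re (a k) * complex.Re (h k).
Proof.
move=> h0; rewrite raddf_sum; apply: eq_bigr => k _.
by have := h0 k; case: (a k) (h k) => [p q] [r s] /= ->; rewrite mulr0 subr0.
Qed.

(** Each generator on one side is expanded on the other: [re_add_imE] gives one inclusion, and
    sesquilinearity in the basis [b] followed by [mul_conjcE] gives the other. *)
Lemma span_real_products (T : Type) (V : set (T -> R[i]^o)) n
    (b : 'I_n -> T -> R[i]^o) :
  linear_span (range b) = V ->
  linear_span (range (fun ij : 'I_n * 'I_n =>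
    (fun x => re_add_im (b ij.1 x * conjc (b ij.2 x))) : T -> R[i]^o)) =
  linear_span (conj_products V).
Proof.
move=> bV; apply: linear_span_eq.
  move=> _ [[i j] _ <-] /=.
  have Vb k : V (b k) by rewrite -bV; apply: sub_linear_span; exists k.
  have [_ UD] := linear_span_subspace (conj_products V).
  rewrite (_ : (fun x => _) =
    conjc half_1i *: ((fun x => b i x * conjc (b j x)) : T -> R[i]^o)
    + (half_1i *: ((fun x => b j x * conjc (b i x)) : T -> R[i]^o) + 0)).
    apply: (UD); first by apply: sub_linear_span; exists (b i), (b j).
    apply: (UD); first by apply: sub_linear_span; exists (b j), (b i).
    by case: (linear_span_subspace (conj_products V)).
  by rewrite addr0; apply/funext => x; exact: re_add_imE.
move=> _ [f [g [+ + ->]]]; rewrite -bV => /linear_span_rangeP[a ->].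
move=> /linear_span_rangeP[c ->].
set G := fun ij : 'I_n * 'I_n => _.
have spanG := linear_span_subspace (range G); have [_ UD] := spanG.
rewrite (_ : (fun x => _) = \sum_i a i *: \sum_j conjc (c j) *:
    (half_1i *: G (i, j) + conjc half_1i *: G (j, i))).
  apply: linear_subspace_sum => // i; apply: linear_subspace_sum => // j.
  apply: (UD); first by apply: sub_linear_span; exists (i, j).
  rewrite -[_ *: _]addr0; apply: (UD); last by case: spanG.
  by apply: sub_linear_span; exists (j, i).
apply/funext => x; rewrite !fct_sumE mulr_suml; apply: eq_bigr => i _.
rewrite /= -mulrA; congr (_ * _); rewrite fct_sumE raddf_sum mulr_sumr.
apply: eq_bigr => j _ /=; rewrite rmorphM /= mulrCA; congr (_ * _).
exact: mul_conjcE.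
Qed.

End RealProducts.

(** * Quadrature for the squared moduli of functions in [V] *)

Theorem theorem4p1 (R : realType) (Omega : ptopologicalType)
    (mu : probability (g_sigma_algebraType (@open Omega)) R) (n : nat)
    (V : set (Omega -> R[i]^o)) :
  compact [set: Omega] ->
  V `<=` continuous_functions R Omega ->
  linear_subspace V ->
  has_dim V n ->
  exists D : nat,
    [/\ has_dim (linear_span (conj_products V)) D,
        (D <= n ^ 2)%N
      & exists (N : nat) (x : 'I_N.+1 -> Omega) (w : 'I_N.+1 -> R),
        [/\ (N <= D)%N,
            forall i, 0 <= w i,
            \sum_(i < N.+1) w i = 1
          & forall f : Omega -> R[i]^o, V f ->
              (\int[mu]_y (sqr_modulus (f y))%:E
               = (\sum_(i < N.+1) w i * sqr_modulus (f (x i)))%:E)%E]].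
Proof.
move=> cOmega Vcont _ [b [_ bV]].
have Vb i : V (b i) by rewrite -bV; apply: sub_linear_span; exists i.
(* Extracting the basis from [A] keeps its members real-valued and continuous; the [n^2] generators
   [g] bound its size. *)
pose A : set (Omega -> R[i]^o) := [set h |
  continuous (fun x => complex.Re (h x)) /\ forall x, complex.Im (h x) = 0].
pose g ij : Omega -> R[i]^o :=
  fun x => re_add_im (b ij.1 x * conjc (b ij.2 x)).
have Ag ij : A (g ij).
  split=> // x.
  have /(_ x) cr1 := continuous_Re _ (Vcont _ (Vb ij.1)).
  have /(_ x) ci1 := continuous_Im _ (Vcont _ (Vb ij.1)).
  have /(_ x) cr2 := continuous_Re _ (Vcont _ (Vb ij.2)).
  have /(_ x) ci2 := continuous_Im _ (Vcont _ (Vb ij.2)).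
  have := continuousD
    (continuousD (continuousM cr1 cr2) (continuousM ci1 ci2))
    (continuousB (continuousM ci1 cr2) (continuousM cr1 ci2)).
  congr (continuous_at _ _); apply/funext => y.
  by rewrite /g /= Re_mul_conjc_add_Im.
have [D [h [Dn Ah indep_h spanh]]] := has_basis_in _ g _ Ag.
have spanV : linear_span (range h) = linear_span (conj_products V).
  by rewrite spanh; exact: span_real_products.
exists D; split.
- by exists h; split.
- by move: Dn; rewrite card_prod card_ord.
pose hr j x := complex.Re (h j x).
have chr j : continuous (hr j) by have [] := Ah j.
pose p j := \int[mu]_y hr j y.
have [c s cs|x [w [w0 w1 pw]]] := convex_quadrature D hr cOmega chr p.
  (* A combination of the [hr j] bounded by [s] has mean at most [s], since [mu] has total mass
     1. *)
  rewrite -lee_fin -Rintegral_sum_continuous//.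
  have -> : s%:E = (\int[mu]_y s%:E)%E.
    rewrite integral_cst// -[LHS]mule1; congr (_ * _)%E.
    by rewrite -(probability_setT mu).
  apply: le_integral => //.
  - apply: (@continuous_integrable _ _ mu cOmega
      (fun y => \sum_j c j * hr j y)).
    apply: continuous_big => [|j _]; first exact: add_continuous.
    by move=> y; exact: (continuousM (@cst_continuous _ _ (c j) y) (chr j y)).
  - apply: (@continuous_integrable _ _ mu cOmega (fun=> s)).
    exact: cst_continuous.
  - by move=> y _; rewrite lee_fin.
(* Here [N] is [D] itself. The formula holds for each [hr j] and passes to [|f|^2] by linearity. *)
exists D, x, w; split=> // f Vf.
have /linear_span_rangeP[a fa] :
    linear_span (range h) (fun x => f x * conjc (f x)).
  by rewrite spanV; apply: sub_linear_span; exists f, f.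
have fE y : sqr_modulus (f y) = \sum_j complex.Re (a j) * hr j y.
  rewrite sqr_modulusE (_ : f y * _ = \sum_j a j * h j y).
    by apply: Re_linear_comb => j; have [_] := Ah j.
  by have /(congr1 (@^~ y)) := fa; rewrite /= fct_sumE.
under eq_integral do rewrite fE.
rewrite Rintegral_sum_continuous//; congr _%:E.
under eq_bigr do rewrite -/(p _) pw mulr_sumr.
rewrite exchange_big; apply: eq_bigr => i _ /=.
by rewrite fE mulr_sumr; apply: eq_bigr => j _; rewrite mulrCA.
Qed.
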